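(* Let $b$ be a prime, $m$ a positive integer and $N=b^m$. Let $0\le w_1\le w_2\le\dotsb$ be integers and, for each $j$, let $$\mathcal{Z}_{N,w_j}=\begin{cases}\{z\in\{1,\dotsc,b^{m-w_j}-1\}:\gcd(z,b^m)=1\} & \text{if } w_j<m,\\ \{1\} & \text{if } w_j\ge m.\end{cases}$$ Let $(\gamma_j)_{j\ge1}$ be a non-increasing sequence of product weights with $0<\gamma_j\le 1$, put $\beta_j=1+\gamma_j$ and $$S_N=\sum_{\substack{-\frac{N}{2}<h\le\frac{N}{2}\\ h\neq 0}}\frac{1}{|h|}.$$ For $\mathbf{z}=(z_1,\dotsc,z_d)$ define $$R_{N,\boldsymbol{\gamma}}^d(\mathbf{z})=\frac{1}{N}\sum_{k=0}^{N-1}\prod_{j=1}^d\left(\beta_j+\gamma_j\sum_{\substack{-\frac{N}{2}<h\le\frac{N}{2}\\ h\neq 0}}\frac{\mathrm{e}^{2\pi\mathrm{i} h k z_j/N}}{|h|}\right)-\prod_{j=1}^d\beta_j .$$ Let $\mathbf{z}=(b^{w_1}z_1,\dotsc,b^{w_s}z_s)$ be constructed by the reduced component-by-component algorithm: set $z_1=1$, and for $d=1,\dotsc,s-1$, with $z_1,\dotsc,z_d$ already fixed, choose $z_{d+1}\in\mathcal{Z}_{N,w_{d+1}}$ minimizing $R_{N,\boldsymbol{\gamma}}^{d+1}(b^{w_1}z_1,\dotsc,b^{w_d}z_d,b^{w_{d+1}}z)$ as a function of $z\in\mathcal{Z}_{N,w_{d+1}}$. Then for every $d\in\{1,\dotsc,s\}$,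 $$R_{N,\boldsymbol{\gamma}}^{d}\left(b^{w_1}z_1,\dotsc,b^{w_d}z_d\right)\le\frac{1}{N}\prod_{j=1}^d\left(\beta_j+\left(1+2b^{\min\{w_j,m\}}\right)\gamma_j S_N\right).$$
   Context: Lattice point sets $P_N(\mathbf{z})=\{\{k\mathbf{z}/N\}:k\}$ with $N=b^m$ points and generating vectors whose $j$-th component is restricted to $b^{w_j}\mathcal{Z}_{N,w_j}$ (reduced search space). The quantity $R_{N,\boldsymbol{\gamma}}^d$ controls the weighted star discrepancy via $D^*_{N,\boldsymbol{\gamma}}(\mathbf{z})\le \sum_{\mathfrak{u}\subseteq[s]}\gamma_{\mathfrak{u}}(1-(1-1/N)^{|\mathfrak{u}|})+\frac12 R_{N,\boldsymbol{\gamma}}^s(\mathbf{z})$. *)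

(* Defs.v *)
From HB Require Import structures.
From mathcomp Require Import all_boot all_order all_algebra.
From mathcomp Require Import reals trigo.
From mathcomp Require Import complex.
Set Implicit Arguments. Unset Strict Implicit. Unset Printing Implicit Defensive.
Import Order.TTheory GRing.Theory Num.Theory.
Local Open Scope ring_scope.
Local Open Scope complex_scope.

Section Defs.
Variable R : realType.

Definition expi (t : R) : R[i] := (cos t) +i* (sin t).

Definition hrange (N : nat) : seq int :=
  [seq h <- [seq (i%:Z - N%:Z)%R | i <- iota 0 (2 * N).+1]
     | (- (N%:Z) < 2 * h)%R && (2 * h <= N%:Z)%R && (h != 0)].

Definition S_N (N : nat) : R := \sum_(h <- hrange N) (`|h|%:~R)^-1.

Definition Zred (b m w : nat) : pred nat :=
  if (w < m)%N then [pred z : nat | (1 <= z <= b ^ (m - w) - 1)%N && coprime z (b ^ m)]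
  else pred1 1.

Definition beta (gamma : nat -> R) (j : nat) : R := 1 + gamma j.

Definition RNg (N : nat) (gamma : nat -> R) (d : nat) (z : nat -> nat) : R[i] :=
  (N%:R)^-1 * \sum_(0 <= k < N) \prod_(1 <= j < d.+1)
     ((beta gamma j)%:C + (gamma j)%:C *
        \sum_(h <- hrange N)
           expi (2 * pi * h%:~R * (k%:R) * ((z j)%:R) / N%:R) / (`|h|%:~R)%:C)
  - (\prod_(1 <= j < d.+1) beta gamma j)%:C.

End Defs.

(* Main.v *)
(* Put phi(t) = sum_h cos(2 pi h t / N) / |h|, so that R^d averages over k the
   product P_d(k) of the factors beta_j + gamma_j phi(k y_j), y_j = b^(w_j) z_j.
   Passing from d to d + 1 multiplies R^d by beta_(d+1) and adds
   gamma_(d+1) / N times sum_k P_d(k) phi(k y_(d+1)).  By minimality this sum is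
   at most its average over the set Z of admissible z, and
   |P_d(k)| <= prod (beta_j + gamma_j S_N), so one has to bound sum_k |B(k)| for
   B(k) = sum_(z in Z) phi(k b^w z).  If w >= m, then phi = S_N throughout.  If
   w < m, put M = b^(m-w) and T(q) = sum_(q | h) 1 / |h|.  By orthogonality of
   characters, B(k) equals |Z| S_N if M divides k, and otherwise
   (M / b)(b T(b q) - T(q)) <= 0 for some q.  As sum_k B(k) >= 0, it follows that
   sum_k |B(k)| <= 2 sum_(M | k) B(k) = 2 b^w |Z| S_N. *)
Require Import Defs.
From HB Require Import structures.
From mathcomp Require Import all_boot all_order all_algebra.
From mathcomp Require Import reals trigo.
From mathcomp Require Import complex.
From mathcomp Require Import ring lra zify.
Import Order.TTheory GRing.Theory Num.Theory.
Local Open Scope ring_scope.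
Local Open Scope complex_scope.

(** * Trigonometry: cosines at rational multiples of pi and their orthogonality *)

Lemma sin_pi_intr (R : realType) (c : int) : sin (pi * c%:~R) = 0 :> R.
Proof.
have sinn (n : nat) : sin (pi * n%:R) = 0 :> R.
  elim: n => [|n IHn]; first by rewrite mulr0 sin0.
  by rewrite -natr1 mulrDr mulr1 sinDpi IHn oppr0.
case: c => n; first exact: sinn.
by rewrite NegzE mulrNz mulrN sinN sinn oppr0.
Qed.

Lemma cos_double (R : realType) (x : R) : cos (2 * x) = 1 - 2 * sin x ^+ 2.
Proof.
rewrite mulrC mulr_natr cos_mulr2n.
by have := cos2Dsin2 x; rewrite -(mulr_natr (_ ^+ 2)); lra.
Qed.

Section Ucos.
Variable R : realType.

Definition ucos (n : nat) (a : int) : R := cos (2 * pi * a%:~R / n%:R).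

Lemma normr_ucos_le1 n a : `|ucos n a| <= 1.
Proof. by rewrite ler_norml cos_geN1 cos_le1. Qed.

Lemma ucosE n a : ucos n a = 1 - 2 * sin (pi * a%:~R / n%:R) ^+ 2.
Proof. by rewrite -cos_double /ucos; congr cos; ring. Qed.

(** For [n] = 0 in the proof below, division by 0 gives the angle 0, so the cosine is still 1. *)
Lemma ucos_dvd n a : (n%:Z %| a)%Z -> ucos n a = 1.
Proof.
case/dvdzP=> q ->; case: n => [|n].
  by rewrite mulr0 /ucos invr0 mulr0 cos0.
rewrite ucosE intrM.
have -> : pi * (q%:~R * (n.+1%:Z)%:~R) / n.+1%:R = pi * q%:~R :> R.
  by rewrite -[(n.+1%:Z)%:~R]/(n.+1%:R) mulrA mulfK // pnatr_eq0.
by rewrite sin_pi_intr expr0n mulr0 subr0.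
Qed.

(** Modulo pi the angle is that of the remainder of [a], which lies strictly between 0 and pi. This
    keeps the divisor in the telescoping sum nonzero. *)
Lemma sin_pi_frac_neq0 n a :
  (0 < n)%N -> ~~ (n%:Z %| a)%Z -> sin (pi * a%:~R / n%:R) != 0 :> R.
Proof.
move=> n_gt0; have nR : n%:R != 0 :> R by rewrite pnatr_eq0; lia.
have nZ : n%:Z != 0 by lia.
rewrite {2}(divz_eq a n) (sameP dvdz_mod0P eqP) => r_neq0.
set q := (a %/ n)%Z; set r := (a %% n)%Z in r_neq0 *.
have r_ge0 : 0 <= r by apply: modz_ge0.
have r_lt : r < n%:Z by rewrite ltz_pmod //; lia.
have -> : pi * (q * n + r)%:~R / n%:R = pi * r%:~R / n%:R + pi * q%:~R :> R.
  by rewrite intrD intrM; field.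
rewrite sinD sin_pi_intr mulr0 addr0 mulf_neq0 //.
  apply: lt0r_neq0; apply: sin_gt0_pi.
  have nR0 : 0 < n%:R :> R by rewrite ltr0n.
  have r0 : 0 < r%:~R :> R by rewrite ltr0z; lia.
  apply/andP; split; first by rewrite divr_gt0 // mulr_gt0 ?pi_gt0.
  by rewrite ltr_pdivrMr // ltr_pM2l ?pi_gt0 // -[n%:R]/((n%:Z)%:~R) ltr_int.
apply/eqP => c0; have := cos2Dsin2 (pi * q%:~R : R).
by rewrite c0 sin_pi_intr expr0n addr0 => /eqP; rewrite eq_sym oner_eq0.
Qed.

(* Multiplying by twice the sine of the half step makes the sum telescope. *)
Lemma sum_ucos n a : (0 < n)%N ->
  \sum_(0 <= k < n) ucos n (a * k%:Z) = if (n%:Z %| a)%Z then n%:R else 0.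
Proof.
move=> n_gt0; case: ifPn => [na|na].
  rewrite (eq_bigr (fun=> 1)) => [|k _]; last by rewrite ucos_dvd ?dvdz_mulr.
  by rewrite big_const_nat iter_addr addr0 subn0.
have nR : n%:R != 0 :> R by rewrite pnatr_eq0; lia.
set y : R := pi * a%:~R / n%:R.
have sy : 2 * sin y != 0.
  by rewrite mulf_neq0 ?pnatr_eq0 // sin_pi_frac_neq0.
apply: (mulfI sy); rewrite mulr0 mulr_sumr.
rewrite (eq_bigr (fun k : nat => sin (2 * k.+1%:R * y - y) - sin (2 * k%:R * y - y))).
  rewrite telescope_sumr // mulr0 mul0r sub0r.
  have -> : 2 * n%:R * y = 2 * (pi * a%:~R) by rewrite /y; field.
  by rewrite sinB cos_double mulr_natl sin_mulr2n sin_pi_intr sinN; ring.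
move=> k _.
have -> : ucos n (a * k%:Z) = cos (2 * k%:R * y).
  by rewrite /ucos intrM /y; congr cos; field.
have -> : 2 * k.+1%:R * y - y = 2 * k%:R * y + y by rewrite -natr1; ring.
by rewrite sinD sinB; ring.
Qed.

Lemma ucos_mulr c n a : (0 < c)%N -> ucos (n * c) (a * c%:Z) = ucos n a.
Proof.
move=> c0; have cR : c%:R != 0 :> R by rewrite pnatr_eq0; lia.
rewrite /ucos natrM intrM; congr cos.
by rewrite invfM -[(c%:Z)%:~R]/(c%:R); move: (n%:R^-1) => u; field.
Qed.

End Ucos.

(** * Multiples, coprime residues and gcds with prime powers *)

Lemma sum_multiples (V : nmodType) (F : nat -> V) (n c : nat) : (0 < c)%N ->
  \sum_(0 <= k < n * c | (c %| k)%N) F k = \sum_(0 <= i < n) F (i * c)%N.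
Proof.
move=> c0; rewrite big_mkcond big_nat_mul; apply: eq_bigr => i _.
rewrite big_ltn ?ltn_pmul2r //= dvdn_mull // big_nat_cond big1 ?addr0 // => j.
rewrite andbT => /andP[lo hi]; case: dvdnP => // -[k jk]; exfalso.
by move: lo hi; rewrite jk !ltn_pmul2r //; lia.
Qed.

Lemma sum_coprime (V : zmodType) (F : nat -> V) (n p : nat) : prime p ->
  \sum_(0 <= k < n * p | coprime k p) F k
  = \sum_(0 <= k < n * p) F k - \sum_(0 <= i < n) F (i * p)%N.
Proof.
move=> p_pr; rewrite -(sum_multiples _ _ _ _ (prime_gt0 p_pr)).
rewrite [X in _ = X - _](bigID (fun k => coprime k p)) /=.
rewrite [X in _ + X - _](eq_bigl (fun k => p %| k)%N) ?addrK // => k.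
by rewrite coprime_sym prime_coprime // negbK.
Qed.

Lemma dvdz_mul_gcd (M k : nat) (h : int) : (0 < M)%N ->
  (M%:Z %| h * k%:Z)%Z = ((M %/ gcdn M k)%N%:Z %| h)%Z.
Proof.
move=> M0; rewrite !dvdzE abszM !absz_nat.
have g0 : (0 < gcdn M k)%N by rewrite gcdn_gt0 M0.
rewrite -{1}(divnK (dvdn_gcdr M k)) -{1}(divnK (dvdn_gcdl M k)) mulnA dvdn_pmul2r // Gauss_dvdl // /coprime -(eqn_pmul2r g0).
by rewrite muln_gcdl !divnK ?dvdn_gcdl ?dvdn_gcdr // mul1n.
Qed.

(** Every divisor of [p ^ r.+1] is a power of [p], and the gcd cannot be the top power. *)
Lemma gcdn_expn_pred (p r k : nat) : prime p -> ~~ (p ^ r.+1 %| k)%N ->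
  gcdn (p ^ r.+1) k = gcdn (p ^ r) k.
Proof.
move=> p_pr ndvd; apply/eqP; rewrite eqn_dvd !dvdn_gcd !dvdn_gcdr !andbT.
apply/andP; split; last by rewrite (dvdn_trans (dvdn_gcdl _ _)) ?dvdn_exp2l.
have /(dvdn_pfactor _ _ p_pr)[i ir gE] := dvdn_gcdl (p ^ r.+1) k.
rewrite gE dvdn_exp2l //; move: ir; rewrite leq_eqVlt => /orP[/eqP iE|//].
by move: ndvd; rewrite -iE -gE dvdn_gcdr.
Qed.

(** * The kernel [phi] and reciprocal sums over multiples *)

Section Kernel.
Variable R : realType.
Variable N : nat.

Lemma mem_hrange (h : int) :
  (h \in hrange N) = [&& - N%:Z < 2 * h, 2 * h <= N%:Z & h != 0].
Proof.
rewrite mem_filter; apply/idP/idP => [/andP[]|h_bd]; first by lia.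
apply/andP; split; first by lia.
apply/mapP; exists (absz (h + N%:Z)); first by rewrite mem_iota; lia.
by lia.
Qed.

Lemma hrange_uniq : uniq (hrange N).
Proof. by rewrite filter_uniq // map_inj_uniq ?iota_uniq // => i j; lia. Qed.

Definition recip_sum (q : nat) : R :=
  \sum_(h <- hrange N | (q%:Z %| h)%Z) (`|h|%:~R)^-1.

Lemma S_N_recip_sum : S_N R N = recip_sum 1.
Proof. by apply: eq_bigl => h; rewrite dvd1z. Qed.

Lemma invr_normz_ge0 (h : int) : 0 <= (`|h|%:~R : R)^-1.
Proof. by rewrite invr_ge0 ler0z. Qed.

Lemma recip_sum_ge0 q : 0 <= recip_sum q.
Proof. by apply: sumr_ge0 => h _; exact: invr_normz_ge0. Qed.

Lemma S_N_ge0 : 0 <= S_N R N.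
Proof. by rewrite S_N_recip_sum recip_sum_ge0. Qed.

(* [h |-> h / c] maps the multiples of [c * q] in the range injectively to
   multiples of [q] in the range. *)
Lemma recip_sum_mul c q : (0 < c)%N ->
  c%:R * recip_sum (c * q) <= recip_sum q.
Proof.
move=> c0; have cR : c%:R != 0 :> R by rewrite pnatr_eq0; lia.
set s := [seq (h %/ c)%Z | h <- hrange N & ((c * q)%N%:Z %| h)%Z].
set t := [seq h <- hrange N | (q%:Z %| h)%Z].
have c_dvd h : ((c * q)%N%:Z %| h)%Z -> exists2 h', h = h' * c%:Z & (q%:Z %| h')%Z.
  case/dvdzP=> a ->; exists (a * q%:Z); last by rewrite dvdz_mull.
  by rewrite PoszM; ring.
have cZ : c%:Z != 0 by lia.
have s_uniq : uniq s.
  rewrite map_inj_in_uniq ?(filter_uniq _ hrange_uniq) // => h1 h2.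
  rewrite !mem_filter => /andP[/c_dvd[a -> _] _] /andP[/c_dvd[a' -> _] _].
  by rewrite !mulzK // => ->.
have s_sub : {subset s <= t}.
  move=> _ /mapP[h + ->]; rewrite mem_filter => /andP[/c_dvd[a -> qa] ain].
  rewrite mulzK // mem_filter qa /=.
  by move: ain; rewrite !mem_hrange; nia.
have -> : c%:R * recip_sum (c * q) = \sum_(h <- s) (`|h|%:~R)^-1.
  rewrite big_map big_filter mulr_sumr; apply: eq_bigr => h /c_dvd[a -> _].
  by rewrite mulzK // normrM intrM invfM mulrCA mulfV ?mulr1.
have -> : \sum_(h <- s) (`|h|%:~R : R)^-1
        = \sum_(h <- t | h \in s) (`|h|%:~R)^-1.
  rewrite -[RHS]big_filter; apply: perm_big; apply: uniq_perm => //.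
    by do 2!apply: filter_uniq; exact: hrange_uniq.
  by move=> h; rewrite [RHS]mem_filter; case: (boolP (h \in s)) => // /s_sub ->.
rewrite /recip_sum -(big_filter (hrange N)) -/t big_mkcond.
by apply: ler_sum => h _; case: ifP => // _; exact: invr_normz_ge0.
Qed.

Lemma recip_sum_le_S_N c : (0 < c)%N -> c%:R * recip_sum c <= S_N R N.
Proof. by move=> c0; rewrite S_N_recip_sum -{2}[c]muln1 recip_sum_mul. Qed.

(** The inner exponential sum of [RNg]; cosines suffice because the sine part cancels over
    [hrange N]. *)
Definition phi (t : nat) : R :=
  \sum_(h <- hrange N) ucos R N (h * t%:Z) / `|h|%:~R.

Lemma normr_phi_le t : `|phi t| <= S_N R N.
Proof.
apply: le_trans (ler_norm_sum _ _ _) _; apply: ler_sum => h _.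
rewrite normrM (ger0_norm (invr_normz_ge0 h)) ler_piMl ?invr_normz_ge0 //.
exact: normr_ucos_le1.
Qed.

Lemma phi_dvd t : (N %| t)%N -> phi t = S_N R N.
Proof.
move=> Nt; apply: eq_bigr => h _.
by rewrite ucos_dvd ?mul1r // dvdz_mull // dvdzE.
Qed.

(** After exchanging the sums, orthogonality keeps exactly the [h] with [h * c] divisible by [N]. *)
Lemma sum_phi c : (0 < N)%N ->
  \sum_(0 <= k < N) phi (k * c) = N%:R * recip_sum (N %/ gcdn N c).
Proof.
move=> N0; rewrite exchange_big /= /recip_sum mulr_sumr [RHS]big_mkcond /=.
apply: eq_bigr => h _; rewrite -mulr_suml.
rewrite (eq_bigr (fun k : nat => ucos R N (h * c%:Z * k%:Z))) => [|k _].
  by rewrite sum_ucos // dvdz_mul_gcd //; case: ifP; rewrite ?mul0r.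
by rewrite PoszM; congr ucos; ring.
Qed.

(* Pairing [h] with [-h] leaves only [h = N / 2], where the sine is that of a
   multiple of [pi]. *)
Lemma sum_sin_hrange (t : nat) :
  \sum_(h <- hrange N) sin (2 * pi * (h * t%:Z)%:~R / N%:R) / `|h|%:~R = 0 :> R.
Proof.
set F := fun h : int => sin (2 * pi * (h * t%:Z)%:~R / N%:R) / `|h|%:~R : R.
pose flip (h : int) := if 2 * h == N%:Z then h else - h.
have flip_perm : perm_eq (hrange N) (map flip (hrange N)).
  apply: uniq_perm; rewrite ?map_inj_in_uniq ?hrange_uniq //.
    by move=> h1 h2; rewrite !mem_hrange /flip; do 2!case: ifP; lia.
  move=> h; apply/idP/mapP => [hin|[h' + ->]].
    move: hin; rewrite mem_hrange => hin.
    exists (flip h); first by rewrite mem_hrange /flip; case: ifP; lia.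
    by rewrite /flip; case: (eqVneq (2 * h)) => e; case: eqVneq; lia.
  by rewrite !mem_hrange /flip; case: ifP; lia.
have flipF h : F (flip h) = - F h.
  rewrite /flip; case: ifP => [/eqP hN|_]; last first.
    by rewrite /F normrN mulNr intrN !(mulrN, mulNr) sinN mulNr.
  suff -> : F h = 0 by rewrite oppr0.
  (* As [2 * h] equals [N], the case [h] = 0 means [N] = 0; the inverse of 0 is 0, so [F h] still
     vanishes. *)
  have [h0|h0] := eqVneq h 0; first by rewrite /F h0 normr0 invr0 mulr0.
  have NE : N%:R = 2 * h%:~R :> R by rewrite -[N%:R]/((N%:Z)%:~R) -hN intrM.
  have hR : h%:~R != 0 :> R by rewrite intr_eq0.
  rewrite /F NE intrM.
  have -> : 2 * pi * (h%:~R * (t%:Z)%:~R) / (2 * h%:~R) = pi * (t%:Z)%:~R :> R.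
    by field.
  by rewrite sin_pi_intr mul0r.
have : \sum_(h <- hrange N) F h = - \sum_(h <- hrange N) F h.
  rewrite {1}(perm_big _ flip_perm) big_map -sumrN.
  by apply: eq_bigr => h _; exact: flipF.
by move/eqP; rewrite -addr_eq0 -mulr2n mulrn_eq0 => /eqP.
Qed.

Lemma sum_expi_hrange (k t : nat) :
  \sum_(h <- hrange N)
     expi (2 * pi * h%:~R * k%:R * t%:R / N%:R) / (`|h|%:~R)%:C
  = (phi (k * t))%:C.
Proof.
pose x (h : int) : R := 2 * pi * (h * (k * t)%N%:Z)%:~R / N%:R.
rewrite (eq_bigr (fun h => (cos (x h) / `|h|%:~R)%:C
                         + 'i%C * (sin (x h) / `|h|%:~R)%:C)) => [|h _].
  by rewrite big_split /= -mulr_sumr -!rmorph_sum sum_sin_hrange mulr0 addr0.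
have -> : 2 * pi * h%:~R * k%:R * t%:R / N%:R = x h.
  by rewrite /x PoszM !intrM; ring.
by rewrite [expi _]complexE !rmorphM mulrA -mulrDl fmorphV.
Qed.

End Kernel.

(** * Averages of [phi] over admissible components *)

Section UnitAverage.
Variable R : realType.

(** Serves the first component, which is fixed at 1 and hence not accessible to averaging. *)
Lemma sum_phi_le (N c : nat) : (0 < N)%N ->
  \sum_(0 <= k < N) phi R N (k * c) <= (gcdn N c)%:R * S_N R N.
Proof.
move=> N0; rewrite sum_phi // -[in N%:R](divnK (dvdn_gcdl N c)) natrM mulrAC.
rewrite mulrC ler_wpM2l ?ler0n // recip_sum_le_S_N //.
by rewrite divn_gt0 ?gcdn_gt0 ?N0 // dvdn_leq ?dvdn_gcdl.
Qed.

Section PrimePower.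
Variables p r c : nat.
Hypotheses (p_pr : prime p) (c_gt0 : (0 < c)%N).

Let M := (p ^ r.+1)%N.
Let N := (M * c)%N.
Let p_gt0 : (0 < p)%N := prime_gt0 p_pr.
Let M_gt0 : (0 < M)%N. Proof. by rewrite expn_gt0 p_gt0. Qed.
Let N_gt0 : (0 < N)%N. Proof. by rewrite muln_gt0 M_gt0. Qed.

(** The factor [c] cancels against [N]. The residues coprime to [p] are all residues minus the
    multiples of [p], so orthogonality applies modulo [M] and modulo [p ^ r]. *)
Lemma sum_phi_coprime k :
  \sum_(0 <= z < M | coprime z p) phi R N (k * (c * z))
  = M%:R * recip_sum R N (M %/ gcdn M k)
    - (p ^ r)%:R * recip_sum R N (p ^ r %/ gcdn (p ^ r) k).
Proof.
rewrite exchange_big /= /recip_sum !mulr_sumr.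
rewrite [X in _ = X - _]big_mkcond [X in _ = _ - X]big_mkcond -sumrB /=.
apply: eq_bigr => h _; rewrite -mulr_suml.
rewrite (eq_bigr (fun z : nat => ucos R M (h * k%:Z * z%:Z))) => [|z _]; last first.
  by rewrite -(ucos_mulr R c M _ c_gt0) !PoszM; congr ucos; ring.
rewrite /M expnSr sum_coprime // sum_ucos -?expnSr //.
rewrite (eq_bigr (fun i : nat => ucos R (p ^ r) (h * k%:Z * i%:Z))) => [|i _].
  rewrite sum_ucos ?expn_gt0 ?p_gt0 // !dvdz_mul_gcd ?expn_gt0 ?p_gt0 //.
  by rewrite mulrBl; do 2!case: ifP; rewrite ?mul0r.
by rewrite expnSr -[RHS](ucos_mulr R p _ _ p_gt0) !PoszM; congr ucos; ring.
Qed.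

(* If [p ^ r.+1] does not divide [k], both gcds in [sum_phi_coprime] agree. *)
Lemma sum_phi_coprime_le0 k : ~~ (M %| k)%N ->
  \sum_(0 <= z < M | coprime z p) phi R N (k * (c * z)) <= 0.
Proof.
move=> Mk; rewrite sum_phi_coprime gcdn_expn_pred // {1 2}/M expnS.
rewrite -muln_divA ?dvdn_gcdl // natrM mulrAC mulrC -mulrBr.
rewrite mulr_ge0_le0 ?ler0n // subr_le0 recip_sum_mul //.
Qed.

Lemma sum_phi_coprime_dvd k : (M %| k)%N ->
  \sum_(0 <= z < M | coprime z p) phi R N (k * (c * z))
  = (count (fun z => coprime z p) (index_iota 0 M))%:R * S_N R N.
Proof.
move=> Mk; rewrite (eq_bigr (fun=> S_N R N)) => [|z _].
  by rewrite big_const_seq iter_addr addr0 mulr_natl.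
by rewrite phi_dvd // mulnA dvdn_mulr // dvdn_pmul2r.
Qed.

(* The inner sum is nonpositive off the multiples of [M], and its total over
   [k] is nonnegative, so the multiples of [M] carry half of the bound. *)
Lemma sum_norm_sum_phi_coprime :
  \sum_(0 <= k < N) `|\sum_(0 <= z < M | coprime z p) phi R N (k * (c * z))|
  <= (count (fun z => coprime z p) (index_iota 0 M))%:R * (2 * c%:R * S_N R N).
Proof.
set B := fun k : nat => \sum_(0 <= z < M | coprime z p) phi R N (k * (c * z)).
set n := (count _ _)%:R.
rewrite -[X in X <= _]/(\sum_(0 <= k < N) `|B k|).
have B_ge0 : 0 <= \sum_(0 <= k < N) B k.
  rewrite exchange_big /=; apply: sumr_ge0 => z _.
  by rewrite sum_phi // mulr_ge0 ?ler0n ?recip_sum_ge0.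
have B_dvd : \sum_(0 <= k < N | (M %| k)%N) B k = c%:R * (n * S_N R N).
  rewrite (eq_bigr (fun=> n * S_N R N)) => [|k]; last exact: sum_phi_coprime_dvd.
  by rewrite /N mulnC sum_multiples // big_const_nat iter_addr addr0 subn0 mulr_natl.
rewrite (bigID (fun k => M %| k)%N) /= in B_ge0.
rewrite (bigID (fun k => M %| k)%N) /=.
rewrite (eq_bigr B) => [|k Mk]; last first.
  by rewrite /B sum_phi_coprime_dvd // ger0_norm // mulr_ge0 ?ler0n ?S_N_ge0.
rewrite [X in _ + X <= _](eq_bigr (fun k => - B k)) => [|k Mk]; last first.
  by rewrite ler0_norm // sum_phi_coprime_le0.
by rewrite sumrN; rewrite B_dvd in B_ge0 *; lra.
Qed.

End PrimePower.

(** The list [Z] treats both cases of [Zred] uniformly; its being nonempty permits averaging. *)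
Lemma Zred_average (b m w : nat) : prime b -> (0 < m)%N ->
  exists Z : seq nat, [/\ (0 < size Z)%N, {subset Z <= Zred b m w}
    & \sum_(0 <= k < b ^ m) `|\sum_(z <- Z) phi R (b ^ m) (k * (b ^ w * z))|
      <= (size Z)%:R * (2 * (b ^ minn w m)%:R * S_N R (b ^ m))].
Proof.
move=> b_pr m0; have b0 := prime_gt0 b_pr; have b1 := prime_gt1 b_pr.
have S0 : 0 <= S_N R (b ^ m) by exact: S_N_ge0.
have [wm|mw] := ltnP w m; last first.
  exists [:: 1%N]; split=> // [z|].
    by rewrite inE /Zred ltnNge mw => /eqP ->; rewrite inE.
  rewrite mul1r (eq_bigr (fun=> S_N R (b ^ m))) => [|k _].
    (* The total is [b ^ m] times [S_N], so the factor 2 is to spare. *)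
    rewrite big_const_nat iter_addr addr0 subn0 -[leLHS]mulr_natl -mulrA ler_peMl //.
      by rewrite mulr_ge0 ?ler0n.
    by rewrite ler1n.
  by rewrite big_seq1 phi_dvd ?ger0_norm // muln1 dvdn_mull // dvdn_exp2l.
have [r mE] : exists r, m = (r.+1 + w)%N by exists (m - w).-1; lia.
have MN : (b ^ r.+1 * b ^ w = b ^ m)%N by rewrite -expnD -mE.
have M1 : (1 < b ^ r.+1)%N by rewrite -{1}(expn0 b) ltn_exp2l.
exists [seq z <- index_iota 0 (b ^ r.+1) | coprime z b]; split.
- rewrite size_filter -has_count; apply/hasP; exists 1%N; last exact: coprime1n.
  by rewrite mem_index_iota.
- move=> z; rewrite mem_filter mem_index_iota => /andP[zb /andP[_ zM]].
  rewrite /Zred wm inE coprimeXr // andbT mE addnK.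
  (* The list starts at 0, but 0 is not coprime to [b]. *)
  have : z != 0 by apply: contraTneq zb => ->; rewrite /coprime gcd0n; lia.
  by lia.
- rewrite size_filter -MN.
  under eq_bigr do rewrite big_filter.
  by apply: sum_norm_sum_phi_coprime; rewrite // expn_gt0 b0.
Qed.

End UnitAverage.

(** * The figure of merit as a real number and its recursion in the dimension *)

Section RealFigure.
Variables (R : realType) (N : nat) (gamma : nat -> R).

Definition lattice_prod (d : nat) (y : nat -> nat) (k : nat) : R :=
  \prod_(1 <= j < d.+1) (beta gamma j + gamma j * phi R N (k * y j)).

Definition RNg_real (d : nat) (y : nat -> nat) : R :=
  N%:R^-1 * \sum_(0 <= k < N) lattice_prod d y k
  - \prod_(1 <= j < d.+1) beta gamma j.

(** Moves comparisons from [R[i]], where the order requires equal imaginary parts, to [R]. *)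
Lemma RNg_realE d y : RNg N gamma d y = (RNg_real d y)%:C.
Proof.
rewrite /RNg rmorphB rmorphM fmorphV rmorph_nat rmorph_sum.
congr (_ * _ - _); apply: eq_bigr => k _; rewrite rmorph_prod.
by apply: eq_bigr => j _; rewrite sum_expi_hrange -rmorphM -rmorphD.
Qed.

Lemma RNg_real0 y : (0 < N)%N -> RNg_real 0 y = 0.
Proof.
move=> N0; rewrite /RNg_real /lattice_prod big_geq // (eq_bigr (fun=> 1)).
  rewrite big_const_nat iter_addr addr0 subn0 mulVf ?subrr // pnatr_eq0; lia.
by move=> k _; rewrite big_geq.
Qed.

Lemma RNg_realS d y : RNg_real d.+1 y =
  beta gamma d.+1 * RNg_real d y
  + gamma d.+1 / N%:R
    * \sum_(0 <= k < N) lattice_prod d y k * phi R N (k * y d.+1).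
Proof.
rewrite /RNg_real big_nat_recr //=.
rewrite (eq_bigr (fun k : nat => beta gamma d.+1 * lattice_prod d y k
   + gamma d.+1 * (lattice_prod d y k * phi R N (k * y d.+1)))) => [|k _].
  by rewrite big_split /= -!mulr_sumr; ring.
by rewrite /lattice_prod big_nat_recr //=; ring.
Qed.

Lemma eq_lattice_prod d y y' : {in [pred j | (1 <= j <= d)%N], y =1 y'} ->
  lattice_prod d y =1 lattice_prod d y'.
Proof. by move=> yy' k; apply: eq_big_nat => j jd; rewrite yy' ?inE. Qed.

Hypothesis gamma_ge0 : forall j, (1 <= j)%N -> 0 <= gamma j.

Lemma norm_lattice_prod_le d y k : `|lattice_prod d y k|
  <= \prod_(1 <= j < d.+1) (beta gamma j + gamma j * S_N R N).
Proof.
rewrite normr_prod big_nat_cond [leRHS]big_nat_cond.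
apply: ler_prod => j; rewrite andbT => /andP[j1 _]; rewrite normr_ge0 /=.
have g0 := gamma_ge0 j j1.
have b0 : 0 <= beta gamma j by rewrite addr_ge0.
rewrite (le_trans (ler_normD _ _)) // ger0_norm // lerD2l.
by rewrite normrM ger0_norm // ler_wpM2l ?normr_phi_le.
Qed.

End RealFigure.

(** * Induction on the dimension, with a minimum bounded by an average *)

Theorem theorem2 (R : realType) (b m s : nat) (w : nat -> nat) (gamma : nat -> R)
    (z : nat -> nat) :
  prime b -> (0 < m)%N ->
  {homo w : i j / (1 <= i <= j)%N >-> (i <= j)%N} ->
  (forall j, (1 <= j)%N -> 0 < gamma j <= 1) ->
  (forall i j, (1 <= i <= j)%N -> gamma j <= gamma i) ->
  z 1%N = 1%N ->
  (forall d, (1 <= d < s)%N ->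
     z d.+1 \in Zred b m (w d.+1) /\
     forall z', z' \in Zred b m (w d.+1) ->
       RNg (b ^ m) gamma d.+1 (fun j => b ^ w j * z j)%N
       <= RNg (b ^ m) gamma d.+1 (fun j => b ^ w j * (if j == d.+1 then z' else z j))%N) ->
  forall d, (1 <= d <= s)%N ->
    RNg (b ^ m) gamma d (fun j => b ^ w j * z j)%N
    <= ((b ^ m)%:R^-1 *
        \prod_(1 <= j < d.+1)
          (beta gamma j + (1 + 2 * (b ^ minn (w j) m)%:R) * gamma j * S_N R (b ^ m)))%:C.
Proof.
move=> b_pr m0 _ gamma_bd _ z1 z_min d d_bd.
rewrite RNg_realE lecR.
have g0 j : (1 <= j)%N -> 0 <= gamma j by case/gamma_bd/andP => /ltW.
have N0 : (0 < b ^ m)%N by rewrite expn_gt0 prime_gt0.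
have S0 : 0 <= S_N R (b ^ m) by exact: S_N_ge0.
have {d_bd} : (d <= s)%N by case/andP: d_bd.
(* Starting at dimension 0, where the figure is 0 and the bound is 1/N, puts the first component
   inside the inductive step. *)
elim: d => [|d IHd] ds.
  by rewrite RNg_real0 // big_geq // mulr1 invr_ge0 ler0n.
set N := (b ^ m)%N in N0 S0 IHd z_min *.
set y := (fun j => b ^ w j * z j)%N in IHd z_min *.
have {}IHd := IHd (ltnW ds).
rewrite big_nat_recr //= RNg_realS.
set C := \prod_(1 <= j < d.+1) _ in IHd *.
have factor_le j : (1 <= j)%N -> beta gamma j + gamma j * S_N R N
    <= beta gamma j + (1 + 2 * (b ^ minn (w j) m)%:R) * gamma j * S_N R N.
  move=> j1; rewrite lerD2l -mulrA ler_peMl ?mulr_ge0 ?g0 //.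
  by rewrite lerDl mulr_ge0 ?ler0n.
have P_le k : `|lattice_prod R N gamma d y k| <= C.
  apply: le_trans (norm_lattice_prod_le R N gamma g0 d y k) _.
  rewrite /C big_nat_cond [leRHS]big_nat_cond.
  apply: ler_prod => j; rewrite andbT => /andP[j1 _]; rewrite factor_le // andbT.
  by rewrite addr_ge0 ?mulr_ge0 ?addr_ge0 ?g0.
have C0 : 0 <= C := le_trans (normr_ge0 _) (P_le 0%N).
have gd := g0 d.+1 isT.
have bd : 0 <= beta gamma d.+1 by rewrite addr_ge0.
set q := (b ^ minn (w d.+1) m)%:R.
have q0 : 0 <= q by rewrite ler0n.
suff conv_le : \sum_(0 <= k < N) lattice_prod R N gamma d y k * phi R N (k * y d.+1)
      <= C * (2 * q * S_N R N).
  have Ninv : 0 <= N%:R^-1 :> R by rewrite invr_ge0 ler0n.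
  apply: le_trans (lerD (ler_wpM2l bd IHd) (ler_wpM2l (mulr_ge0 gd Ninv) conv_le)) _.
  (* The summand 1 in [1 + 2 * q] is pure slack here: it is the whole difference of the two
     bounds. *)
  rewrite -subr_ge0; have -> : N%:R^-1 *
      (C * (beta gamma d.+1 + (1 + 2 * q) * gamma d.+1 * S_N R N))
    - (beta gamma d.+1 * (N%:R^-1 * C)
       + gamma d.+1 * N%:R^-1 * (C * (2 * q * S_N R N)))
    = N%:R^-1 * C * (gamma d.+1 * S_N R N) by ring.
  by rewrite !mulr_ge0.
(* The first component is prescribed, not minimizing; there the product is empty and the sum is
   estimated directly through a gcd. *)
have [d0|d_gt0] := posnP d.
  rewrite /q /C /lattice_prod d0; under [leLHS]eq_bigr do rewrite big_geq // mul1r.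
  rewrite [X in _ <= X * _]big_geq // mul1r /y z1 muln1.
  apply: le_trans (sum_phi_le R N (b ^ w 1%N) N0) _.
  suff -> : gcdn N (b ^ w 1%N) = (b ^ minn (w 1%N) m)%N.
    by rewrite ler_wpM2r // ler_peMl ?ler1n.
  have [wm|mw] := leqP (w 1%N) m; first by apply/gcdn_idPr; rewrite dvdn_exp2l.
  by apply/gcdn_idPl; rewrite dvdn_exp2l // ltnW.
have [_ {}z_min] := z_min d ltac:(by rewrite d_gt0).
have [Z [Z0 Zsub Z_avg]] := Zred_average R b m (w d.+1) b_pr m0.
have gd_gt0 : 0 < gamma d.+1 by case/andP: (gamma_bd d.+1 isT).
(* Changing component [d.+1] leaves [RNg_real] at [d] unchanged, and the coefficient of the sum in
   the recursion is positive, so minimality passes to the sum itself. *)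
have Zc_min z' : z' \in Z ->
    \sum_(0 <= k < N) lattice_prod R N gamma d y k * phi R N (k * y d.+1)
    <= \sum_(0 <= k < N) lattice_prod R N gamma d y k
         * phi R N (k * (b ^ w d.+1 * z')).
  move/Zsub/z_min; rewrite !RNg_realE lecR !RNg_realS eqxx.
  set y' := (fun j => b ^ w j * (if j == d.+1 then z' else z j))%N.
  have PE : lattice_prod R N gamma d y' =1 lattice_prod R N gamma d y.
    apply: eq_lattice_prod => j; rewrite inE /y /y' => /andP[_ jd].
    by rewrite ltn_eqF.
  have -> : RNg_real R N gamma d y' = RNg_real R N gamma d y.
    by rewrite /RNg_real (eq_bigr _ (fun k _ => PE k)).
  rewrite lerD2l ler_pM2l ?divr_gt0 ?ltr0n //.
  by under [X in _ <= X -> _]eq_bigr do rewrite PE.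
have ZR : 0 < (size Z)%:R :> R by rewrite ltr0n.
(* Multiplied by the size of [Z], the minimum is compared with the sum over all of [Z]. *)
rewrite -(ler_pM2l ZR).
apply: (@le_trans _ _ (\sum_(z' <- Z) \sum_(0 <= k < N)
    lattice_prod R N gamma d y k * phi R N (k * (b ^ w d.+1 * z')))).
  rewrite mulr_natl -[(size Z)]count_predT -[leLHS]addr0 -iter_addr -big_const_seq.
  by rewrite big_seq [leRHS]big_seq; exact: ler_sum.
rewrite exchange_big /=; under eq_bigr do rewrite -mulr_sumr.
apply: (@le_trans _ _ (\sum_(0 <= k < N)
    C * `|\sum_(z' <- Z) phi R N (k * (b ^ w d.+1 * z'))|)).
  apply: ler_sum => k _; apply: le_trans (ler_norm _) _.
  by rewrite normrM ler_wpM2r.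
by rewrite -mulr_sumr mulrCA ler_wpM2l.
Qed.
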